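(* Let $G$ be a graph, let $v_0\in V(G)$, and let $k\ge 1$ be an integer. The map $S^{(k)}_{v_0}:\operatorname{Div}^k_+(G)\to\operatorname{Jac}(G)$ is injective if and only if $G$ is $(k+1)$-edge-connected.
   Context: A graph is a finite connected multigraph with no loop edges. For $m\ge 2$, $G$ is $m$-edge-connected if $G-W$ is connected for every set $W$ of at most $m-1$ edges (by convention, the graph with one vertex and no edges is $m$-edge-connected for all $m$). $\operatorname{Div}(G)$ is the free abelian group on $V(G)$ (divisors $D=\sum_v D(v)(v)$), $\deg(D)=\sum_v D(v)$, $D$ effective if all $D(v)\ge 0$; $\operatorname{Div}^k_+(G)$ is the set of effective divisors of degree $k$ and $\operatorname{Div}^0(G)$ the divisors of degree $0$. For $f:V(G)\to\mathbb{Z}$ the Laplacian is $\Delta(f)=\sum_v\big(\sum_{e=vw\in E_v}(f(v)-f(w))\big)(v)$, the inner sum over edges incident to $v$ with multiplicity; $\operatorname{Prin}(G)=\{\Delta(f)\}$. The Jacobian is $\operatorname{Jac}(G)=\operatorname{Div}^0(G)/\operatorname{Prin}(G)$, with $[D]$ the class of $D$. $S_{v_0}(v)=[(v)-(v_0)]$ and $S^{(k)}_{v_0}((v_1)+\cdots+(v_k))=S_{v_0}(v_1)+\cdots+S_{v_0}(v_k)$. *)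

(* Defs.v *)
From HB Require Import structures.
From mathcomp Require Import all_boot all_order all_algebra.
From mathcomp Require Import boolp.

Set Implicit Arguments.
Unset Strict Implicit.
Unset Printing Implicit Defensive.

Import GRing.Theory Num.Theory.
Local Open Scope ring_scope.
Local Open Scope quotient_scope.

(* Parallel edges are distinct elements of [edge] with the same ends; the
   cardinality condition excludes loops. *)
Record multigraph := MultiGraph {
  vertex : finType;
  edge : finType;
  ends : edge -> {set vertex};
  card_ends : forall e, #|ends e| = 2%N
}.

Definition adjacent (G : multigraph) : rel (vertex G) :=
  fun u v => [exists e : edge G, ends e == [set u; v]].

Definition connected_graph (G : multigraph) : Prop :=
  (0 < #|vertex G|)%N /\ forall u v : vertex G, connect (@adjacent G) u v.

Definition delete_edges (G : multigraph) (W : {set edge G}) : multigraph :=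
  @MultiGraph (vertex G) {e : edge G | e \notin W}
    (fun e => ends (val e)) (fun e => card_ends (val e)).

Definition edge_connected (m : nat) (G : multigraph) : Prop :=
  forall W : {set edge G}, (#|W| <= m.-1)%N ->
    connected_graph (delete_edges W).

Section Divisors.
Variable G : multigraph.

Definition divisor := {ffun vertex G -> int}.
HB.instance Definition _ := GRing.Zmodule.on divisor.

Definition point (v : vertex G) : divisor := [ffun w => (w == v)%:Z].

Definition deg (D : divisor) : int := \sum_v D v.

Definition effective (D : divisor) : bool := [forall v, 0 <= D v].

Record eff_divisor (k : nat) := EffDivisor {
  eff_val :> divisor;
  eff_valP : effective eff_val && (deg eff_val == k%:Z)
}.
HB.instance Definition _ k := [isSub for @eff_val k].
HB.instance Definition _ k := [Choice of eff_divisor k by <:].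

Fact deg_is_zmod_morphism : zmod_morphism deg.
Proof.
move=> D D'; rewrite /deg -sumrB; apply: eq_bigr => v _.
by rewrite !ffunE.
Qed.
HB.instance Definition _ :=
  GRing.isZmodMorphism.Build divisor int deg deg_is_zmod_morphism.

Lemma deg_point v : deg (point v) = 1.
Proof.
rewrite /deg (bigD1 v) //= ffunE eqxx big1 ?addr0 // => w /negPf wv.
by rewrite ffunE wv.
Qed.

Definition deg_zero : {pred divisor} := fun D => deg D == 0.

Lemma deg_zeroE D : (D \in deg_zero) = (deg D == 0). Proof. by []. Qed.

Fact deg_zero_zmod_closed : zmod_closed deg_zero.
Proof.
split=> [|D D']; rewrite !deg_zeroE ?raddf0 // raddfB /=.
by move=> /eqP-> /eqP->; rewrite subrr.
Qed.
HB.instance Definition _ :=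
  GRing.isZmodClosed.Build divisor deg_zero deg_zero_zmod_closed.

Record divisor0 := Divisor0 {
  divisor0_val :> divisor;
  divisor0_valP : divisor0_val \in deg_zero
}.
HB.instance Definition _ := [isSub for divisor0_val].
HB.instance Definition _ := [Choice of divisor0 by <:].
HB.instance Definition _ := [SubChoice_isSubZmodule of divisor0 by <:].

(* The second endpoint w of an edge e incident to v is the only element of
   ends e :\ v. *)
Definition laplacian (f : vertex G -> int) : divisor :=
  [ffun v => \sum_(e : edge G | v \in ends e) \sum_(w in ends e :\ v)
    (f v - f w)].

Definition principal (D : divisor) : Prop := exists f, D = laplacian f.

Lemma laplacianB f g :
  laplacian (fun v => f v - g v) = laplacian f - laplacian g.
Proof.
apply/ffunP => v; rewrite !ffunE -sumrB; apply: eq_bigr => e _.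
by rewrite -sumrB; apply: eq_bigr => w _; rewrite !opprD !opprK addrACA.
Qed.

Lemma laplacian_deg_zero f : laplacian f \in deg_zero.
Proof.
rewrite deg_zeroE; apply/eqP; rewrite /deg.
under eq_bigr do rewrite ffunE.
rewrite (exchange_big_dep predT) //= big1 // => e _.
have /eqP/cards2P[x [y [xy ->]]] := card_ends e.
have sym : y \in [set x] = false by rewrite inE eq_sym (negPf xy).
rewrite big_setU1 ?inE //= big_set1.
rewrite setU1K ?inE // big_set1 [[set x; y]]setUC setU1K ?sym // big_set1.
by rewrite addrC subrKA subrr.
Qed.

Definition prin0 : {pred divisor0} := fun D => `[< principal D >].

Lemma prin0P (D : divisor0) : reflect (principal D) (D \in prin0).
Proof. exact: asboolP. Qed.

Fact prin0_zmod_closed : zmod_closed prin0.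
Proof.
split=> [|D D'].
  apply/prin0P; exists (fun=> 0).
  by apply/ffunP => v; rewrite !ffunE big1 // => e _; rewrite big1 ?subrr.
move=> /prin0P[f Df] /prin0P[g Dg]; apply/prin0P.
by exists (fun v => f v - g v); rewrite laplacianB -Df -Dg.
Qed.
HB.instance Definition _ :=
  GRing.isZmodClosed.Build divisor0 prin0 prin0_zmod_closed.

Definition jacobian : zmodType := Quotient.quot prin0.

Definition jac_class (D : divisor0) : jacobian :=
  \pi_(Quotient.quot prin0) D.

Lemma jac_classE D D' :
  jac_class D = jac_class D' <-> principal (D - D' : divisor).
Proof.
rewrite /jac_class; split.
  by move/eqP; rewrite -Quotient.idealrBE => /prin0P.
by move=> p; apply/eqP; rewrite -Quotient.idealrBE; apply/prin0P.
Qed.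

Fact point_sub_deg_zero v w : point v - point w \in deg_zero.
Proof. by rewrite deg_zeroE raddfB /= !deg_point subrr. Qed.

Variable v0 : vertex G.

Definition abel_jacobi (v : vertex G) : jacobian :=
  jac_class (Divisor0 (point_sub_deg_zero v v0)).

(* The points of an effective divisor D are listed with multiplicity D v;
   see abel_jacobi_sum_points. *)
Definition abel_jacobi_sum (k : nat) (D : eff_divisor k) : jacobian :=
  \sum_v abel_jacobi v *~ eff_val D v.

Lemma abel_jacobi_sum_points (k : nat) (D : eff_divisor k)
    (s : 'I_k -> vertex G) :
  D = \sum_i point (s i) :> divisor ->
  abel_jacobi_sum D = \sum_i abel_jacobi (s i).
Proof.
move=> Ds; rewrite /abel_jacobi_sum.
have -> : \sum_v abel_jacobi v *~ eff_val D v =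
          \sum_v \sum_i abel_jacobi v *~ point (s i) v.
  by apply: eq_bigr => v _; rewrite Ds sum_ffunE -mulrz_sumr.
rewrite exchange_big; apply: eq_bigr => i _ /=.
rewrite (bigD1 (s i)) //= ffunE eqxx big1 ?addr0 ?mulr1z // => v /negPf vi.
by rewrite ffunE vi mulr0z.
Qed.

End Divisors.

(* Main.v *)
Require Import Defs.
From mathcomp Require Import all_boot all_order all_algebra.
From mathcomp Require Import zify.

(** Two effective divisors of degree [k] have the same image exactly when they
    differ by a principal divisor [laplacian f].  Summing [laplacian f] over
    the set [A] where [f] is maximal bounds the size of the edge cut of [A]
    from above by [k], so a nonconstant [f] yields a disconnecting set of at
    most [k] edges.  Conversely, the Laplacian of the indicator function of a
    side of a small cut is a difference of two effective divisors supported on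
    the two sides of the cut; padding with copies of [v0] gives degree [k]. *)

Set Implicit Arguments.
Unset Strict Implicit.
Unset Printing Implicit Defensive.

Import Order.TTheory GRing.Theory Num.Theory.
Local Open Scope ring_scope.
Local Open Scope quotient_scope.

Definition edge_cut (G : multigraph) (A : {set vertex G}) : {set edge G} :=
  [set e | (ends e :&: A != set0) && (ends e :\: A != set0)].

Section Cuts.
Variable G : multigraph.
Implicit Types (A : {set vertex G}) (e : edge G).

Lemma edge_endsP e : exists x y, x != y /\ ends e = [set x; y].
Proof. by have /eqP/cards2P := card_ends e. Qed.

Lemma in_edge_cut A e x y : ends e = [set x; y] ->
  (e \in edge_cut A) = ((x \in A) != (y \in A)).
Proof.
move=> Ee; rewrite inE Ee.
apply/andP/idP => [[/set0Pn[u] /setIP[]] | ].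
  rewrite !inE => /orP[]/eqP-> uA /set0Pn[w] /setDP[];
  by rewrite !inE => /orP[]/eqP-> /negPf wA; move: uA; rewrite ?wA // => ->.
case xA: (x \in A); case yA: (y \in A) => // _; split; apply/set0Pn.
- by exists x; rewrite !inE eqxx xA.
- by exists y; rewrite !inE eqxx yA orbT.
- by exists y; rewrite !inE eqxx yA orbT.
- by exists x; rewrite !inE eqxx xA.
Qed.

(** If no edge crossed [A], then [A] would be closed under adjacency, so every vertex connected to
    [u] would lie in [A]. *)
Lemma connected_edge_cut A u v :
  connected_graph G -> u \in A -> v \notin A -> edge_cut A != set0.
Proof.
move=> [_ conn] uA; apply: contraNneq => cut0.
have clA : closed (@adjacent G) (mem A).
  move=> x y /existsP[e /eqP Ee].
  by apply/eqP/negPn; rewrite -(in_edge_cut A Ee) cut0 inE.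
by rewrite -(closed_connect clA (conn u v)).
Qed.

Lemma adjacent_sym : symmetric (@adjacent G).
Proof. by move=> x y; apply: eq_existsb => e; rewrite setUC. Qed.

End Cuts.

(** Deletion leaves the ends of the surviving edges unchanged, so an edge crossing [A] in
    [delete_edges W] is an edge outside [W] that crosses [A] in [G]. *)
Lemma connected_delete_edge_cut (G : multigraph) (A : {set vertex G})
    (W : {set edge G}) u v :
    connected_graph (delete_edges W) -> u \in A -> v \notin A ->
  ~~ (edge_cut A \subset W).
Proof.
move=> conn uA vA; have /set0Pn[e] :=
  @connected_edge_cut (delete_edges W) A u v conn uA vA.
rewrite inE => ecut; apply/subsetPn; exists (val e); last exact: (valP e).
by rewrite inE.
Qed.

Section LaplacianSums.
Variable G : multigraph.
Implicit Types (A : {set vertex G}) (e : edge G).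

(** An edge with both ends in [A] contributes two opposite differences, which cancel. A crossing
    edge contributes a single difference: on the right, each inner sum ranges over one vertex, which
    orients the edge out of [A]. *)
Lemma sum_laplacian A f :
  \sum_(v in A) laplacian f v =
  \sum_(e in edge_cut A)
     \sum_(v in ends e :&: A) \sum_(w in ends e :\: A) (f v - f w).
Proof.
under eq_bigr do rewrite ffunE.
rewrite (exchange_big_dep predT) //= [RHS]big_mkcond /=.
apply: eq_bigr => e _; have [x [y [xy Ee]]] := edge_endsP e.
rewrite (in_edge_cut A Ee) Ee.
have yx : y \in [set x] = false by rewrite inE eq_sym (negPf xy).
have Dx : [set x; y] :\ x = [set y] by rewrite setU1K ?inE.
have Dy : [set x; y] :\ y = [set x] by rewrite setUC setU1K ?yx.
rewrite big_mkcondl big_setU1 ?inE //= big_set1 Dx Dy !big_set1.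
have side a b : a \in A -> b \notin A -> [set a; b] = [set x; y] ->
    ([set x; y] :&: A = [set a]) /\ ([set x; y] :\: A = [set b]).
  move=> aA /negPf bA <-.
  have ab : (a == b) = false by apply: contraFF bA => /eqP <-.
  split; apply/setP=> z; rewrite !inE; have [->|_] := eqVneq z a.
  - by rewrite aA.
  - by have [->|_] := eqVneq z b; rewrite ?bA.
  - by rewrite aA ab.
  - by have [->|_] := eqVneq z b; rewrite ?bA ?andbF.
case xA: (x \in A); case yA: (y \in A) => /=.
- by rewrite addrC subrKA subrr.
- by have [-> ->] := side x y xA (negbT yA) erefl; rewrite !big_set1 addr0.
- have [-> ->] := side y x yA (negbT xA) (setUC _ _).
  by rewrite !big_set1 add0r.
- by rewrite addr0.
Qed.

Lemma laplacian_const c : laplacian (fun _ : vertex G => c) = 0.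
Proof.
by apply/ffunP => v; rewrite !ffunE big1 // => e _; rewrite big1 ?subrr.
Qed.

Lemma card_ends_edge_cut e A : e \in edge_cut A ->
  #|ends e :&: A| = 1%N /\ #|ends e :\: A| = 1%N.
Proof.
rewrite inE -!card_gt0 => /andP[I D].
by have := cardsID A (ends e); rewrite card_ends; split; lia.
Qed.

(** Each crossing edge contributes a positive integer, hence at least 1. *)
Lemma sum_laplacian_ge A f :
    (forall v w, v \in A -> w \notin A -> f w < f v) ->
  #|edge_cut A|%:Z <= \sum_(v in A) laplacian f v.
Proof.
move=> fA; rewrite sum_laplacian -sum1_card raddf_sum /=.
apply: ler_sum => e /card_ends_edge_cut[/eqP/cards1P[x Ix] /eqP/cards1P[y Dy]].
have /setIP[_ xA] : x \in ends e :&: A by rewrite Ix inE.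
have /setDP[_ yA] : y \in ends e :\: A by rewrite Dy inE.
by rewrite Ix Dy !big_set1; have := fA _ _ xA yA; lia.
Qed.

Lemma sum_laplacian_indicator A :
  \sum_(v in A) laplacian (fun v => (v \in A)%:Z) v = #|edge_cut A|%:Z.
Proof.
rewrite sum_laplacian -sum1_card raddf_sum /=.
apply: eq_bigr => e /card_ends_edge_cut[/eqP/cards1P[x Ix] /eqP/cards1P[y Dy]].
have /setIP[_ xA] : x \in ends e :&: A by rewrite Ix inE.
have /setDP[_ /negPf yA] : y \in ends e :\: A by rewrite Dy inE.
by rewrite Ix Dy !big_set1 xA yA.
Qed.

Lemma laplacian_indicator_sign A v :
  if v \in A then 0 <= laplacian (fun w => (w \in A)%:Z) v
  else laplacian (fun w => (w \in A)%:Z) v <= 0.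
Proof.
case: ifPn => vA; rewrite ffunE.
  apply: sumr_ge0 => e _; apply: sumr_ge0 => w _.
  by rewrite vA; case: (w \in A).
rewrite -oppr_ge0 -sumrN; apply: sumr_ge0 => e _.
rewrite -sumrN; apply: sumr_ge0 => w _.
by rewrite (negPf vA); case: (w \in A).
Qed.

Lemma divisor_sum_points (D : divisor G) : D = \sum_v point v *~ D v.
Proof.
apply/ffunP => w; rewrite sum_ffunE (bigD1 w) //= big1 => [|v vw].
  by rewrite addr0 ffunMzE ffunE eqxx intz.
by rewrite ffunMzE ffunE eq_sym (negPf vw) mul0rz.
Qed.

End LaplacianSums.

(** The image of [E] is the class of [E] minus [k] copies of [v0]; since both divisors have degree
    [k], these copies cancel in the difference. *)
Lemma abel_jacobi_sum_eq (G : multigraph) (v0 : vertex G) (k : nat)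
    (D D' : eff_divisor G k) :
  abel_jacobi_sum v0 D = abel_jacobi_sum v0 D' <->
  principal (eff_val D - eff_val D').
Proof.
pose P v := Divisor0 (point_sub_deg_zero v v0).
have classE (E : eff_divisor G k) :
    abel_jacobi_sum v0 E = jac_class (\sum_v P v *~ eff_val E v).
  rewrite /abel_jacobi_sum /abel_jacobi /jac_class raddf_sum /=.
  by apply: eq_bigr => v _; rewrite raddfMz.
have valE (E : eff_divisor G k) :
    divisor0_val (\sum_v P v *~ eff_val E v) = eff_val E - point v0 *~ k%:Z.
  rewrite -[divisor0_val _]/(\val _) raddf_sum.
  have /andP[_ /eqP <-] := eff_valP E.
  rewrite /deg mulrz_sumr [X in X - _]divisor_sum_points -sumrB.
  by apply: eq_bigr => v _; rewrite raddfMz /= mulrzBl.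
rewrite !classE jac_classE -[divisor0_val _]/(\val _) raddfB /= !valE.
by rewrite opprB addrA subrK.
Qed.

Lemma edge_connected_injective (G : multigraph) (v0 : vertex G) (k : nat) :
  edge_connected k.+1 G -> injective (@abel_jacobi_sum G v0 k).
Proof.
move=> conn D D' /abel_jacobi_sum_eq[f Df]; apply: val_inj => /=.
pose m := [arg max_(v > v0) f v]%O; pose A := [set v | f v == f m].
have fm v : f v <= f m by rewrite /m; case: arg_maxP => // i _; apply.
(* If [A] is everything, [f] is constant, its Laplacian vanishes and [D = D']. *)
have [/forallP fc|/forallPn[w wA]] := boolP [forall v, v \in A].
  apply/eqP; rewrite -subr_eq0 Df -(laplacian_const G (f m)); apply/eqP.
  apply/ffunP => v; rewrite !ffunE.
  apply: eq_bigr => e _; apply: eq_bigr => w _.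
  by have := fc v; have := fc w; rewrite !inE => /eqP-> /eqP->.
have mA : m \in A by rewrite inE.
(* On [A], [D - D'] is at most [D] because [D'] is effective; the values of [D] on [A] sum to at
   most [deg D = k] because [D] is effective. *)
have cutk : (#|edge_cut A| <= k)%N.
  rewrite -lez_nat; apply: (le_trans (sum_laplacian_ge (f := f) _)).
    by move=> u v; rewrite !inE => /eqP-> vm; rewrite lt_neqAle vm fm.
  have /andP[/forallP D0 /eqP <-] := eff_valP D.
  have /andP[/forallP D'0 _] := eff_valP D'.
  rewrite -Df /deg [leRHS](bigID (mem A)) /= -[leLHS]addr0.
  apply: lerD; last by apply: sumr_ge0 => v _; apply: D0.
  by apply: ler_sum => v _; rewrite !ffunE gerBl D'0.
by have := connected_delete_edge_cut (conn _ cutk) mA wA; rewrite subxx.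
Qed.

Lemma injective_edge_connected (G : multigraph) (v0 : vertex G) (k : nat) :
  connected_graph G -> injective (@abel_jacobi_sum G v0 k) ->
  edge_connected k.+1 G.
Proof.
move=> conn inj W Wk; split; first by apply/card_gt0P; exists v0.
move=> u v; apply/negPn/negP => uv.
pose H := delete_edges W.
pose A : {set vertex G} := [set x | connect (@adjacent H) u x].
have uA : u \in A by rewrite inE connect0.
have vA : v \notin A by rewrite inE.
(* [A] is the component of [u] after deleting [W], so an edge outside [W] cannot leave it. *)
have cutW : edge_cut A \subset W.
  apply/subsetP => e; apply: contraLR => eW.
  have [x [y [_ Ee]]] := edge_endsP e.
  rewrite (in_edge_cut A Ee) negbK.
  have xy : @adjacent H x y.
    by apply/existsP; exists (exist _ e eW : edge H); rewrite /= Ee.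
  have yx : @adjacent H y x by rewrite adjacent_sym.
  apply/eqP; rewrite !inE.
  by apply/idP/idP => /connect_trans; apply; apply: connect1.
have cutk := leq_trans (subset_leq_card cutW) Wk.
pose L := laplacian (fun x => (x \in A)%:Z).
(* The part of [L] on [A] is its positive part, of degree [#|edge_cut A|]. This is at most [k], so
   the truncated subtraction is exact. Then [D - L] is the negative part of [L], with its sign
   changed, plus the same padding. *)
pose pad := point v0 *~ (k - #|edge_cut A|)%N%:Z.
pose D : divisor G := [ffun x => if x \in A then L x else 0] + pad.
have pad0 x : 0 <= pad x.
  by rewrite ffunMzE ffunE; case: (x == v0); rewrite ?mul0rz.
have degD : deg D = k%:Z.
  rewrite /D raddfD /= raddfMz /= deg_point intz /deg.
  under eq_bigr do rewrite ffunE.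
  by rewrite -big_mkcond sum_laplacian_indicator; move: cutk => /=; lia.
have Deff : effective D && (deg D == k%:Z).
  rewrite degD eqxx andbT; apply/forallP => x.
  rewrite ffunE [X in X + _]ffunE; apply: addr_ge0 (pad0 x).
  by have := laplacian_indicator_sign A x; case: ifP.
have D'eff : effective (D - L) && (deg (D - L) == k%:Z).
  have /eqP degL : deg L == 0 := laplacian_deg_zero _.
  rewrite raddfB /= degD degL subr0 eqxx andbT.
  apply/forallP => x; rewrite /D addrAC ffunE [X in X + _]ffunE.
  rewrite [X in X + _ + _]ffunE [X in _ + X + _]ffunE.
  apply: addr_ge0 (pad0 x).
  have := laplacian_indicator_sign A x; rewrite -/L.
  by case: ifP => _; rewrite ?subrr // sub0r oppr_ge0.
have /(congr1 (@eff_val _ _)) /= : EffDivisor Deff = EffDivisor D'eff.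
  apply: inj; apply/abel_jacobi_sum_eq => /=.
  by exists (fun x => (x \in A)%:Z); rewrite opprB addrC subrK.
(* Equality of [D] and [D - L] forces [L = 0]. The sum of [L] over [A] counts the cut, which would
   then be empty although [G] is connected. *)
move=> /(congr1 (fun E => D - E)); rewrite subrr opprB addrC subrK => L0.
have := connected_edge_cut conn uA vA; rewrite -card_gt0.
have := sum_laplacian_indicator A; rewrite -/L -L0.
by rewrite big1 => [[<-]//|x _]; rewrite ffunE.
Qed.

Theorem theorem1p5 (G : multigraph) (G_connected : connected_graph G)
    (v0 : vertex G) (k : nat) (k_ge1 : (1 <= k)%N) :
  injective (@abel_jacobi_sum G v0 k) <-> edge_connected k.+1 G.
Proof.
split; first exact: injective_edge_connected.
exact: edge_connected_injective.
Qed.
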